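(* Let $\mathcal{O}$ be an order ideal in $\mathbb{T}^n$, and let $I\subset P$ be an ideal which has an $\mathcal{O}$-border basis. Then, for a generically chosen linear change of coordinates $\varphi$ (i.e. for all $\varphi$ represented by points in some non-empty Zariski-open subset of the scheme $\mathbb{L}$ of linear coordinate changes), the ideal $\varphi(I)$ has again an $\mathcal{O}$-border basis.
   Context: $K$ is a field, $P=K[x_1,\dots,x_n]$, and $\mathbb{T}^n$ is the monoid of terms (power products). An order ideal is a finite set $\mathcal{O}=\{t_1,\dots,t_\mu\}\subset\mathbb{T}^n$ closed under forming divisors; its border is $\partial\mathcal{O}=(x_1\mathcal{O}\cup\cdots\cup x_n\mathcal{O})\setminus\mathcal{O}=\{b_1,\dots,b_\nu\}$. An ideal $I$ has an $\mathcal{O}$-border basis if the residue classes of the elements of $\mathcal{O}$ form a $K$-basis of $P/I$ (the border basis then consists of the polynomials $b_j-\sum_i\gamma_{ij}t_i\in I$ with $\gamma_{ij}\in K$). A linear change of coordinates is a $K$-algebra automorphism $\varphi:P\to P$ with $\varphi(x_i)=\alpha_{i0}+\alpha_{i1}x_1+\cdots+\alpha_{in}x_n$, $\alpha_{ij}\in K$. It is represented by the point $(\alpha_{ij})$ of $\mathbb{L}=\mathrm{Spec}(K[a_{ij}]_\Delta)$, the open subscheme of $\mathbb{A}^{n(n+1)}$ (coordinates $a_{ij}$, $i=1,\dots,n$, $j=0,\dots,n$) given by $\Delta=\det\bigl((a_{ij})_{i,j=1,\dots,n}\bigr)\ne0$. *)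

(* Defs.v *)
From mathcomp Require Export all_boot all_order all_algebra.
From mathcomp Require Export finmap boolp classical_sets mpoly.

Set Implicit Arguments.
Unset Strict Implicit.
Unset Printing Implicit Defensive.

Import GRing.Theory.

Local Open Scope ring_scope.
Local Open Scope classical_set_scope.

(* [idealr_closed] of ring_quotient only describes proper ideals, whereas the
   unit ideal is allowed here: it is the ideal with a border basis for the
   empty order ideal. *)
Definition is_ideal (A : comNzRingType) (I : set A) : Prop :=
  I 0 /\ forall a u v : A, I u -> I v -> I (a * u + v).

Definition is_prime_ideal (A : comNzRingType) (p : set A) : Prop :=
  idealr_closed [pred x | x \in p] /\ prime_idealr_closed [pred x | x \in p].

Section BorderBasis.

Variables (K : fieldType) (n : nat).

(* (s <= t)%MM is divisibility of terms. *)
Definition order_ideal (O : {fset 'X_{1..n}}) : Prop :=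
  forall t s : 'X_{1..n}, t \in O -> (s <= t)%MM -> s \in O.

(* The residue classes of the terms in O are linearly independent in P/I and
   generate P/I; P/I has no library quotient here, as I is an arbitrary
   (undecidable, possibly improper) ideal. *)
Definition has_border_basis (O : {fset 'X_{1..n}})
    (I : set {mpoly K[n]}) : Prop :=
  (forall c : 'X_{1..n} -> K,
     I (\sum_(t <- O) c t *: 'X_[t]) -> forall t, t \in O -> c t = 0) /\
  (forall f : {mpoly K[n]}, exists c : 'X_{1..n} -> K,
     I (f - \sum_(t <- O) c t *: 'X_[t])).

(* Column 0 of alpha holds the constant terms. *)
Definition linear_change (alpha : 'M[K]_(n, n.+1))
    (phi : {lrmorphism {mpoly K[n]} -> {mpoly K[n]}}) : Prop :=
  bijective phi /\
  forall i : 'I_n,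
    phi 'X_i = (alpha i ord0)%:MP
               + \sum_(j < n) alpha i (lift ord0 j) *: 'X_j.

End BorderBasis.

Section CoordinateChanges.

Variables (K : fieldType) (n : nat).

(* K[a_ij | 1 <= i <= n, 0 <= j <= n]. *)
Definition coord_ring := {mpoly K[n * n.+1]}.

Definition coord (i : 'I_n) (j : 'I_n.+1) : coord_ring :=
  'X_(mxvec_index i j).

Definition Delta : coord_ring := \det (\matrix_(i, j) coord i (lift ord0 j)).

(* The underlying set of Spec(K[a_ij]_Delta), as the open subscheme
   Delta <> 0 of Spec(K[a_ij]). *)
Definition Lspace : set (set coord_ring) :=
  [set p | is_prime_ideal p /\ ~ p Delta].

Definition zero_locus (S : set coord_ring) : set (set coord_ring) :=
  [set p | is_prime_ideal p /\ S `<=` p].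

Definition zariski_open (U : set (set coord_ring)) : Prop :=
  exists S : set coord_ring, U = Lspace `\` zero_locus S.

(* The maximal ideal (a_ij - alpha_ij), i.e. the kernel of evaluation. *)
Definition rational_point (alpha : 'M[K]_(n, n.+1)) : set coord_ring :=
  [set g | g.@[fun k => mxvec alpha ord0 k] = 0].

End CoordinateChanges.

(* Main.v *)
Require Import Defs.
From HB Require Import structures.

(** Normal forms modulo I are coordinates: an ideal with an O-border basis is
the kernel of a linear map N from P to the rows indexed by O that sends the
terms of O to the standard basis ([border_basis_coordinates]). Conversely, the
kernel of a linear map to these rows has an O-border basis as soon as the square
matrix of the images of the terms of O is invertible
([border_basis_of_unitmx]).

Since phi(I) is the kernel of N o phi^-1, the condition on alpha is that the
matrix with rows N (phi^-1 (t)), t in O, is invertible. The inverse of phi is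
x |-> A^-1 (x - a_0), where A is the linear part and a_0 the constant part of
alpha, and A^-1 = adj A / det A. Hence phi^-1 (t) is det(A)^(-deg t) times
  Y_t(alpha) = prod_i ((adj A (x - a_0))_i)^(t_i)
([linear_change_scaled_inverse_term]), whose coefficients are polynomials in
the entries of alpha. As det A is nonzero on the space of linear changes, the
powers of det A only rescale the rows, and the condition becomes g(alpha) <> 0
for the polynomial g(alpha) = det (N (Y_t(alpha)))_t. The open set is the locus
in L where g does not vanish. It contains the rational point of the identity,
where Y_t = t and therefore g = 1, so it is non-empty over every field, finite
ones included. *)

Set Implicit Arguments.
Unset Strict Implicit.
Unset Printing Implicit Defensive.

Import GRing.Theory.

Local Open Scope ring_scope.
Local Open Scope classical_set_scope.

(** * Border bases and coordinates modulo an ideal *)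

Definition term_at (n : nat) (O : {fset 'X_{1..n}}) (i : 'I_(size O)) :=
  tnth (in_tuple O) i.
Arguments term_at {n} O i.

Lemma sum_term_at (n : nat) (O : {fset 'X_{1..n}})
    (V : nmodType) (F : 'X_{1..n} -> V) :
  \sum_(t <- O) F t = \sum_i F (term_at O i).
Proof. exact: big_tnth. Qed.

Lemma coefficients_of_row (K : fieldType) (n : nat) (O : {fset 'X_{1..n}})
    (v : 'rV[K]_(size O)) :
  exists c : 'X_{1..n} -> K, forall i, c (term_at O i) = v 0 i.
Proof.
(* The sum has one term if t is in O, as O has no repetition, and none
   otherwise. *)
exists (fun t => \sum_(i | term_at O i == t) v 0 i) => i.
rewrite (big_pred1 i) // => j; apply/eqP/eqP => [|-> //].
have /tuple_uniqP inj : uniq (in_tuple O) by exact: fset_uniq.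
exact: inj.
Qed.

(** The map N takes f to the coordinates of its class in the basis O of P/I.
Linear independence of O makes these coordinates unique, and uniqueness makes
the chosen map linear. *)
Lemma border_basis_coordinates (K : fieldType) (n : nat)
    (O : {fset 'X_{1..n}}) (I : set {mpoly K[n]}) :
  is_ideal I -> has_border_basis O I ->
  exists N : {linear {mpoly K[n]} -> 'rV[K]_(size O)},
    (forall f, I f <-> N f = 0) /\
    (forall i, N 'X_[term_at O i] = delta_mx 0 i).
Proof.
move=> [I0 IL] [indep span].
have ID a b : I a -> I b -> I (a + b).
  by move=> Ia Ib; have := IL 1 _ _ Ia Ib; rewrite mul1r.
have IN a : I a -> I (- a).
  by move=> Ia; have := IL (-1) _ _ Ia I0; rewrite mulN1r addr0.
have IZ (c : K) a : I a -> I (c *: a).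
  by move=> Ia; have := IL c%:MP _ _ Ia I0; rewrite addr0 mul_mpolyC.
pose lc (v : 'rV[K]_(size O)) : {mpoly K[n]} :=
  \sum_i v 0 i *: 'X_[term_at O i].
have lcL c u v : lc (c *: u + v) = c *: lc u + lc v.
  rewrite /lc scaler_sumr -big_split; apply: eq_bigr => i _ /=.
  by rewrite !mxE scalerDl scalerA.
have lc_inj v : I (lc v) -> v = 0.
  have [c cE] := coefficients_of_row v.
  move=> Iv; apply/rowP => i; rewrite mxE -cE.
  apply: indep; last exact: mem_tnth.
  rewrite sum_term_at; move: Iv; congr I.
  by apply: eq_bigr => j _; rewrite cE.
have /choice[N NE] f : exists v, I (f - lc v).
  have [c Ic] := span f; exists (\row_i c (term_at O i)).
  move: Ic; rewrite sum_term_at; congr (I (_ - _)).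
  by apply: eq_bigr => i _; rewrite mxE.
have Nuniq f v : I (f - lc v) -> N f = v.
  move=> Iv; apply/eqP; rewrite -subr_eq0; apply/eqP/lc_inj.
  rewrite -scaleN1r addrC lcL scaleN1r.
  have := ID _ _ Iv (IN _ (NE f)); congr I.
  by rewrite opprB addrC addrA subrK addrC.
have NL : linear N.
  move=> c f h; apply: Nuniq; rewrite lcL.
  have := ID _ _ (IZ c _ (NE f)) (NE h); congr I.
  by rewrite scalerBr opprD addrACA.
pose L : {linear {mpoly K[n]} -> 'rV[K]_(size O)} :=
  HB.pack N (GRing.isLinear.Build _ _ _ _ N NL).
have lc0 : lc 0 = 0 by rewrite /lc big1 // => i _; rewrite mxE scale0r.
exists L; split=> [f | i] /=.
  split=> [If | Nf0]; first by apply: Nuniq; rewrite lc0 subr0.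
  by have := NE f; rewrite Nf0 lc0 subr0.
apply: Nuniq; rewrite /lc (bigD1 i) //= big1 => [|j /negPf ji].
  by rewrite mxE !eqxx scale1r addr0 subrr.
by rewrite mxE ji andbF scale0r.
Qed.

(** N identifies P/I with a subspace of the rows indexed by O; an invertible
matrix says that the terms of O are mapped to a basis of the space of rows, so
N is onto and their classes form a basis of P/I. *)
Lemma border_basis_of_unitmx (K : fieldType) (n : nat)
    (O : {fset 'X_{1..n}}) (I : set {mpoly K[n]})
    (N : {linear {mpoly K[n]} -> 'rV[K]_(size O)}) :
  (forall f, I f <-> N f = 0) ->
  (\matrix_i N 'X_[term_at O i]) \in unitmx -> has_border_basis O I.
Proof.
set M := \matrix_i _ => kerN uM.
have NE (c : 'X_{1..n} -> K) :
    N (\sum_(t <- O) c t *: 'X_[t]) = (\row_i c (term_at O i)) *m M.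
  rewrite sum_term_at linear_sum mulmx_sum_row; apply: eq_bigr => i _.
  by rewrite linearZ mxE rowK.
split=> [c /kerN | f].
  rewrite NE => /(canRL (mulmxK uM)); rewrite mul0mx => c0 t tO.
  have /tnthP[i ->] : t \in in_tuple O by [].
  by have /rowP/(_ i) := c0; rewrite !mxE.
have [c cE] := coefficients_of_row (N f *m invmx M).
exists c; apply/kerN; rewrite linearB NE.
have -> : \row_i c (term_at O i) = N f *m invmx M.
  by apply/rowP => i; rewrite mxE cE.
by rewrite mulmxKV // subrr.
Qed.

(** * Denominator-free inverses of linear changes of coordinates *)

Section InverseTerms.

Variables (R : comNzRingType) (n : nat).
Implicit Types (A : 'M[R]_(n, n.+1)).

Definition linear_part A : 'M[R]_n := \matrix_(i, j) A i (lift ord0 j).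

(** This is det A times the inverse image of x_i, for A the linear part. The
adjugate replaces the inverse matrix, so that the definition makes sense over
any commutative ring, in particular for the matrix of indeterminates. *)
Definition scaled_inverse_coord A (i : 'I_n) : {mpoly R[n]} :=
  \sum_j \adj (linear_part A) i j *: ('X_j - (A j ord0)%:MP).

Definition scaled_inverse_term A (t : 'X_{1..n}) : {mpoly R[n]} :=
  \prod_i scaled_inverse_coord A i ^+ t i.

End InverseTerms.

(** Applied to an evaluation f, this specializes the matrix of indeterminates
to a given linear change. *)
Lemma map_scaled_inverse_term (R S : comNzRingType) (n : nat)
    (f : {rmorphism R -> S}) (A : 'M[R]_(n, n.+1)) (t : 'X_{1..n}) :
  map_mpoly f (scaled_inverse_term A t) = scaled_inverse_term (map_mx f A) t.
Proof.
rewrite rmorph_prod; apply: eq_bigr => i _; rewrite rmorphXn; congr (_ ^+ _).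
rewrite rmorph_sum; apply: eq_bigr => j _ /=.
have -> : linear_part (map_mx f A) = map_mx f (linear_part A).
  by apply/matrixP => k l; rewrite !mxE.
rewrite -map_mx_adj -mul_mpolyC rmorphM rmorphB /= !map_mpolyC map_mpolyX.
by rewrite mul_mpolyC !mxE.
Qed.

Lemma lift0_neq0 n (i : 'I_n) : (ord0 == lift ord0 i) = false.
Proof. exact/negbTE/neq_lift. Qed.

Definition identity_change (R : comNzRingType) n : 'M[R]_(n, n.+1) :=
  \matrix_(i, j) (j == lift ord0 i)%:R.

Lemma linear_part_identity (R : comNzRingType) n :
  linear_part (identity_change R n) = 1%:M.
Proof.
by apply/matrixP => i j; rewrite !mxE (inj_eq lift_inj) eq_sym.
Qed.

Lemma scaled_inverse_term_identity (R : comNzRingType) n (t : 'X_{1..n}) :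
  scaled_inverse_term (identity_change R n) t = 'X_[t].
Proof.
rewrite mpolyXE_id; apply: eq_bigr => i _; congr (_ ^+ _).
have adj1 : \adj (1%:M : 'M[R]_n) = 1%:M.
  by rewrite -[LHS]mul1mx mul_mx_adj det1.
rewrite /scaled_inverse_coord linear_part_identity adj1 (bigD1 i) //=.
rewrite big1 ?addr0 => [|j /negPf ji]; last first.
  by rewrite mxE eq_sym ji scale0r.
by rewrite !mxE eqxx lift0_neq0 mpolyC0 subr0 scale1r.
Qed.

(** On coordinates this is adj A * A = det A: phi sends x - a_0 to A x. *)
Lemma linear_change_scaled_inverse_term (K : fieldType) (n : nat)
    (alpha : 'M[K]_(n, n.+1))
    (phi : {lrmorphism {mpoly K[n]} -> {mpoly K[n]}}) (t : 'X_{1..n}) :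
  linear_change alpha phi ->
  phi (scaled_inverse_term alpha t) =
    \det (linear_part alpha) ^+ mdeg t *: 'X_[t].
Proof.
move=> [_ phiX]; set A := linear_part alpha.
have phiY i : phi (scaled_inverse_coord alpha i) = \det A *: 'X_i.
  have phi_sub j : phi ('X_j - (alpha j ord0)%:MP) = \sum_k A j k *: 'X_k.
    rewrite rmorphB /= phiX -alg_mpolyC linearZ rmorph1 /= addrAC subrr add0r.
    by apply: eq_bigr => k _; rewrite mxE.
  rewrite linear_sum.
  under eq_bigr => j _ do rewrite linearZ /= phi_sub scaler_sumr.
  rewrite exchange_big /=.
  transitivity (\sum_k (\adj A *m A) i k *: ('X_k : {mpoly K[n]})).
    apply: eq_bigr => k _; rewrite mxE scaler_suml.
    by apply: eq_bigr => j _; rewrite scalerA.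
  rewrite mul_adj_mx (bigD1 i) //= big1 ?addr0 => [|j /negPf ji].
    by rewrite mxE eqxx.
  by rewrite mxE eq_sym ji scale0r.
rewrite rmorph_prod mdegE -prodrXr mpolyXE_id -scaler_prod.
by apply: eq_bigr => i _; rewrite rmorphXn /= phiY exprZn.
Qed.

(** * The polynomial that cuts out the bad coordinate changes *)

Section ScalarExtension.

Variables (K : fieldType) (n N : nat) (k : nat).
Variable l : {linear {mpoly K[n]} -> 'rV[K]_k}.

(** The K[a]-linear extension of l to K[a][x]: it carries out the reduction
modulo I for all values of the indeterminates a at once, and so shows that the
resulting coordinates are polynomials in a. *)
Definition scalar_extension (F : {mpoly {mpoly K[N]}[n]}) :
    'rV[{mpoly K[N]}]_k :=
  \sum_(m <- msupp F) F@_m *: map_mx (@mpolyC N K) (l 'X_[m]).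

Lemma eval_scalar_extension (v : 'I_N -> K) F :
  map_mx (meval v) (scalar_extension F) = l (map_mpoly (meval v) F).
Proof.
rewrite /map_mpoly /mmap /= linear_sum; apply/rowP => i.
rewrite mxE !summxE rmorph_sum; apply: eq_bigr => m _.
by rewrite mmap1_id mul_mpolyC linearZ !mxE rmorphM /= mevalC.
Qed.

End ScalarExtension.

Definition generic_change (K : fieldType) n :
    'M[{mpoly K[n * n.+1]}]_(n, n.+1) :=
  \matrix_(i, j) coord K i j.

Lemma eval_generic_change (K : fieldType) n (alpha : 'M[K]_(n, n.+1)) :
  map_mx (meval (mxvec alpha ord0)) (generic_change K n) = alpha.
Proof. by apply/matrixP => i j; rewrite !mxE /coord mevalXU mxvecE. Qed.

Lemma eval_Delta (K : fieldType) n (alpha : 'M[K]_(n, n.+1)) :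
  (Delta K n).@[mxvec alpha ord0] = \det (linear_part alpha).
Proof.
rewrite -det_map_mx; congr (\det _); apply/matrixP => i j.
by rewrite !mxE /= mevalXU mxvecE.
Qed.

(** The rational point is the kernel of a ring morphism to a field. *)
Lemma rational_point_prime (K : fieldType) n (alpha : 'M[K]_(n, n.+1)) :
  is_prime_ideal (rational_point alpha).
Proof.
have memE u : (u \in [pred x | x \in rational_point alpha]) =
    (u.@[mxvec alpha ord0] == 0).
  by rewrite inE; apply/idP/eqP => [/set_mem | /mem_set].
split; first split; rewrite ?memE ?meval0 ?meval1 ?oner_eq0 //.
  move=> a u v; rewrite !memE mevalD mevalM => /eqP-> /eqP->.
  by rewrite mulr0 addr0.
by move=> u v; rewrite !memE mevalM mulf_eq0.
Qed.

Theorem corollary2p14 (K : fieldType) (n : nat) (O : {fset 'X_{1..n}})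
    (I : set {mpoly K[n]}) :
  order_ideal O -> is_ideal I -> has_border_basis O I ->
  exists U : set (set (coord_ring K n)),
    zariski_open U /\ U !=set0 /\
    forall (alpha : 'M[K]_(n, n.+1))
           (phi : {lrmorphism {mpoly K[n]} -> {mpoly K[n]}}),
      linear_change alpha phi -> U (rational_point alpha) ->
      has_border_basis O (phi @` I).
Proof.
move=> _ idI /(border_basis_coordinates idI)[N [kerN NX]].
pose M (alpha : 'M[K]_(n, n.+1)) : 'M[K]_(size O) :=
  \matrix_i N (scaled_inverse_term alpha (term_at O i)).
pose g : coord_ring K n := \det (\matrix_i
  scalar_extension N (scaled_inverse_term (generic_change K n) (term_at O i))).
have gE alpha : g.@[mxvec alpha ord0] = \det (M alpha).
  rewrite -det_map_mx; congr (\det _); apply/row_matrixP => i.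
  by rewrite -map_row !rowK eval_scalar_extension map_scaled_inverse_term
             eval_generic_change.
exists (@Lspace K n `\` zero_locus [set g]); split; first by exists [set g].
split.
  exists (rational_point (identity_change K n)).
  have prime_id := rational_point_prime (identity_change K n).
  split; first split=> //.
    rewrite /rational_point /= eval_Delta linear_part_identity det1.
    by move/eqP; rewrite oner_eq0.
  case=> _ /(_ g erefl); rewrite /rational_point /= gE.
  have -> : M (identity_change K n) = 1%:M.
    apply/row_matrixP => i.
    by rewrite rowK scaled_inverse_term_identity NX row1.
  by rewrite det1 => /eqP; rewrite oner_eq0.
move=> alpha phi phiP [[primep notDelta] notg].
have d_neq0 : \det (linear_part alpha) != 0.
  by apply/eqP; rewrite -eval_Delta.
have uM : M alpha \in unitmx.
  rewrite unitmxE unitfE -gE; apply/eqP => g0.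
  by apply: notg; split=> // h ->.
have [psi phiK psiK] := phiP.1.
have psiL : linear psi.
  move=> c f h; apply: (can_inj phiK).
  by rewrite psiK linearP /= !psiK.
pose Psi : {linear {mpoly K[n]} -> {mpoly K[n]}} :=
  HB.pack psi (GRing.isLinear.Build _ _ _ _ psi psiL).
pose d := \row_i (\det (linear_part alpha) ^- mdeg (term_at O i)).
apply: (@border_basis_of_unitmx _ _ _ _ (N \o Psi)) => [f /=|].
  split=> [[h Ih <-] | /kerN Ipsi]; first by rewrite phiK; apply/kerN.
  by exists (psi f).
(* phi^-1 (t) is Y_t divided by the power deg t of det A. *)
have -> : \matrix_i (N \o Psi) 'X_[term_at O i] = diag_mx d *m M alpha.
  apply/row_matrixP => i; rewrite row_mul row_diag_mx -scalemxAl -rowE !rowK mxE.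
  rewrite -linearZ; congr (N _); apply: (can_inj phiK).
  rewrite /= psiK linearZ /= (linear_change_scaled_inverse_term _ phiP).
  by rewrite scalerA mulVf ?scale1r // expf_neq0.
rewrite unitmx_mul uM andbT unitmxE det_diag unitfE.
by apply/prodf_neq0 => i _; rewrite mxE invr_eq0 expf_neq0.
Qed.
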